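(* For every integer $n\ge 7$ there exists a graph $G$ on $n$ vertices with the following properties: (1) there exist distinct nonadjacent vertices $x,y\in V(G)$ such that $d(x)+d(y)=n-1$; (2) for these $x,y$, the graph $G+xy$ is Hamiltonian but $G$ is not Hamiltonian; (3) $\tau(G)=1$.
   Context: All graphs are finite and simple. $d(v)$ is the degree of $v$ in $G$. For distinct nonadjacent vertices $x,y$ of $G$, $G+xy$ is the graph obtained from $G$ by adding the edge $xy$. A graph is Hamiltonian if it has a cycle through all its vertices. $c(H)$ denotes the number of connected components of a graph $H$. The toughness $\tau(G)$ of a non-complete graph $G$ is $\min\{|S|/c(G-S) : S\subseteq V(G),\ c(G-S)\ge 2\}$, and $\tau(G)=\infty$ if $G$ is complete. *)

(* Defs.v *)
From HB Require Import structures.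
From mathcomp Require Import all_boot all_order all_algebra.
From mathcomp Require Import constructive_ereal.

Set Implicit Arguments.
Unset Strict Implicit.
Unset Printing Implicit Defensive.

Import Order.TTheory GRing.Theory Num.Theory.

Record sgraph (T : finType) := SGraph {
  adj :> rel T;
  adj_sym : symmetric adj;
  adj_irr : irreflexive adj
}.

Section Graphs.
Variable T : finType.
Implicit Types (G : sgraph T) (S : {set T}).

Definition deg G (v : T) : nat := #|[set w | adj G v w]|.

Definition complete G : bool := [forall x, forall y, (x != y) ==> adj G x y].

(* The guard u != v only serves to make the relation irreflexive when x = y;
   it is redundant when x != y. *)
Definition add_edge_rel G (x y : T) : rel T :=
  fun u v => adj G u v ||
    (u != v) && ((u == x) && (v == y) || (u == y) && (v == x)).

Lemma add_edge_sym G x y : symmetric (add_edge_rel G x y).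
Proof.
move=> u v; rewrite /add_edge_rel adj_sym eq_sym; congr (_ || _ && _).
by rewrite orbC andbC [(u == x) && _]andbC.
Qed.

Lemma add_edge_irr G x y : irreflexive (add_edge_rel G x y).
Proof. by move=> u; rewrite /add_edge_rel adj_irr eqxx. Qed.

Definition add_edge G (x y : T) : sgraph T :=
  SGraph (add_edge_sym G x y) (add_edge_irr G x y).

(* ucycle allows the empty sequence, a single edge traversed back and forth,
   etc.; a cycle of a simple graph has at least 3 vertices. *)
Definition hamiltonian G : Prop :=
  exists s : seq T, [/\ ucycle (adj G) s, 2 < size s & forall v, v \in s].

(* The edges of G - S, as a relation on T: the vertices of S become isolated
   and are not counted in ncomp below. *)
Definition del_rel G S : rel T :=
  fun u v => [&& u \notin S, v \notin S & adj G u v].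

(* c(G - S) *)
Definition ncomp G S : nat := n_comp (del_rel G S) (~: S).

Definition toughness G : \bar rat :=
  if complete G then +oo%E
  else \big[Order.min/+oo%E]_(S : {set T} | 2 <= ncomp G S)
         ((#|S|%:R / (ncomp G S)%:R)%R : rat)%:E.

End Graphs.

(* Main.v *)
Require Import Defs.
From mathcomp Require Import all_boot all_order all_algebra.
From mathcomp Require Import constructive_ereal.
From mathcomp Require Import zify.

(** Join a universal vertex c to the graph obtained from a clique K on n - 4
    vertices by attaching pendant vertices b1, b2, b3 to distinct a1, a2, a3
    in K; take x = b1 and y = a2.  Each b_i has only the neighbours c and a_i,
    so a Hamiltonian cycle would use the three edges c b_i.  If G - S is
    disconnected then c is in S, and each component of G - S other than that
    of K is a single b_i with a_i in S, so G - S has at most |S| components;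
    S = {c, a1} gives equality. *)

Set Implicit Arguments.
Unset Strict Implicit.
Unset Printing Implicit Defensive.

Import Order.TTheory GRing.Theory Num.Theory.

(** After rotating [s] to [x :: a :: b :: q], the successor of [x] is [a] and its predecessor is the
    last entry of [b :: q], which differs from [a] by uniqueness. *)
Lemma next_neq_prev (T : eqType) (s : seq T) (x : T) :
  uniq s -> 2 < size s -> x \in s -> next s x != prev s x.
Proof.
move=> Us s_gt2 xs; have [i p Ep] := rot_to xs.
rewrite -(next_rot i Us) -(prev_rot i Us) Ep.
have : uniq (x :: p) by rewrite -Ep rot_uniq.
have : 2 < size (x :: p) by rewrite -Ep size_rot.
case: p {Ep} => [|a [|b q]] // _ /andP[xp /and3P[ap _ _]].
have Eprev c p : x \notin p -> prev_at x x c p = last c p.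
  elim: p c => [|d p IH] c /=; first by rewrite eqxx.
  by rewrite inE negb_or => /andP[/negPf -> /IH].
have -> : next (x :: a :: b :: q) x = a by rewrite /= eqxx.
have -> : prev (x :: a :: b :: q) x = last b q by rewrite /prev Eprev.
by apply: contraNneq ap => ->; apply: mem_last.
Qed.

(** [n_comp e a] counts the canonical roots lying in [a]; here all of them are connected to [x], so
    they coincide. *)
Lemma card_roots_in_le1 (T : finType) (e : rel T) (a : {pred T}) (x : T) :
  connect_sym e -> {in a, forall y, connect e x y} -> n_comp e a <= 1.
Proof.
move=> eC H; apply/card_le1_eqP => u v.
rewrite !inE => /andP[/eqP ru /H xu] /andP[/eqP rv /H xv].
rewrite -ru -rv. apply/(fingraph.rootP eC).
by rewrite (connect_trans _ xu) // eC.
Qed.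

Lemma n_comp_gt1 (T : finType) (e : rel T) (a : {pred T}) (x y : T) :
  connect_sym e -> closed e a -> x \in a -> y \in a -> ~~ connect e x y ->
  1 < n_comp e a.
Proof.
move=> eC ca xa ya xy; apply/card_gt1P; exists (fingraph.root e x), (fingraph.root e y).
rewrite !inE !(roots_root eC) -!(closed_connect ca (connect_root e _)).
by rewrite xa ya (root_connect eC).
Qed.

Lemma del_connect_sym (T : finType) (G : sgraph T) (S : {set T}) :
  connect_sym (del_rel G S).
Proof.
by apply: sym_connect_sym => u v; rewrite /del_rel adj_sym andbCA.
Qed.

Lemma del_closed (T : finType) (G : sgraph T) (S : {set T}) :
  closed (del_rel G S) (~: S).
Proof. by move=> u v /and3P[uS vS _]; rewrite !inE uS vS. Qed.

Lemma toughness_eq1 (T : finType) (G : sgraph T) (S0 : {set T}) :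
  ~~ complete G -> (forall S, 2 <= ncomp G S -> ncomp G S <= #|S|) ->
  2 <= ncomp G S0 -> #|S0| = 2 -> toughness G = 1%E.
Proof.
move=> Gnc H S0c S0card; rewrite /toughness (negPf Gnc).
apply/le_anti/andP; split.
  apply: le_trans (bigmin_le_cond _ _ S0c) _.
  rewrite lee_fin ler_pdivrMr ?ltr0n ?mul1r ?ler_nat ?S0card //.
  exact: leq_trans S0c.
(* The default [+oo] of the minimum also has to be at least 1. *)
apply: le_bigmin => [|S Sc]; first by rewrite leey.
rewrite lee_fin ler_pdivlMr ?ltr0n ?mul1r ?ler_nat ?H //.
exact: leq_trans Sc.
Qed.

(** Encoding: c = 0, b_i = i, a_i = i + 3, and K is the set of k > 3. *)
Definition netR : rel nat := fun u v =>
  (u != v) &&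
  [|| u == 0, v == 0, (3 < u) && (3 < v), v == u + 3 | u == v + 3].

Definition net_rel n : rel 'I_n := fun u v => netR u v.

Lemma net_sym n : symmetric (@net_rel n).
Proof. move=> u v; rewrite /net_rel /netR; lia. Qed.

Lemma net_irr n : irreflexive (@net_rel n).
Proof. by move=> u; rewrite /net_rel /netR eqxx. Qed.

Definition net n : sgraph 'I_n := SGraph (@net_sym n) (@net_irr n).

Section Net.
Variable m : nat.
Let n := 7 + m.
Let G := net n.
(** The vertex with label [k]; [inord] sends labels out of range to vertex 0, so [k < n] has to be
    checked at each use. *)
Let o k : 'I_n := inord k.

Let oK k : k < 7 -> nat_of_ord (o k) = k.
Proof. by move=> k7; rewrite inordK // /n; lia. Qed.

Lemma deg_net1 : deg G (o 1) = 2.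
Proof.
rewrite /deg (_ : [set w | _] = [set o 0; o 4]).
  by rewrite cards2 -val_eqE /= !oK.
by apply/setP=> w; rewrite !inE -!val_eqE /= /net_rel /netR !oK //; lia.
Qed.

Lemma deg_net5 : deg G (o 5) = n - 3.
Proof.
(* The vertex a2 = 5 is adjacent to c, b2 and the rest of K, so it misses only b1, b3 and itself. *)
rewrite /deg (_ : [set w | _] = ~: [set o 1; o 3; o 5]).
  apply: (canRL (addnK _)); rewrite -[RHS]card_ord -(cardsC [set o 1; o 3; o 5]).
  rewrite -setUA !cardsU1 cards1 !inE -!val_eqE /= !oK //=.
  by rewrite addnC.
by apply/setP=> w; rewrite !inE -!val_eqE /= /net_rel /netR !oK //; lia.
Qed.

Lemma path_net_iota k l : 3 < k -> path netR k (iota k.+1 l).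
Proof.
elim: l k => //= l IH k k3; rewrite IH ?andbT; last by lia.
by rewrite /netR; lia.
Qed.

Lemma net_add_edge_hamiltonian : hamiltonian (add_edge G (o 1) (o 5)).
Proof.
(* The cycle is c, b3, a3, the rest of K outside a1 and a2, then a1, b1, a2, b2 and back to c. It
   uses the new edge from b1 to a2, and [e] contains that edge in this direction only. *)
pose t := [:: 0, 3 & iota 6 m.+1 ++ [:: 4; 1; 5; 2]].
pose e u v := netR u v || (u == 1) && (v == 5).
have tn : {in t, forall k, k < n}.
  by move=> k; rewrite /n !inE mem_cat mem_iota !inE; lia.
have vt : map val (map o t) = t.
  by rewrite -map_comp map_id_in // => k /tn kn; rewrite /= inordK.
have et : cycle e t.
  rewrite /t [cycle _ _]/= rcons_cat cat_path /= (sub_path _ (path_net_iota _ _)) //.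
    have : last 6 (iota 7 m) \in 6 :: iota 7 m by apply: mem_last.
    by rewrite inE mem_iota /e /netR; lia.
  by move=> u v; rewrite /e => ->.
exists (map o t); split.
- apply/andP; split; last first.
    rewrite -(map_inj_uniq val_inj) vt /t !cons_uniq cat_uniq iota_uniq.
    by rewrite !(inE, mem_cat, mem_iota) /= !mem_iota; lia.
  rewrite -vt cycle_map in et; apply: sub_cycle et => u v.
  rewrite /= /add_edge_rel /= /e /net_rel -!val_eqE /= !oK // /netR; lia.
- by rewrite size_map /= size_cat addn4.
- move=> v; rewrite -(mem_map val_inj) vt !inE mem_cat mem_iota !inE.
  by have := ltn_ord v; rewrite /n /=; lia.
Qed.

Lemma net_not_hamiltonian : ~ hamiltonian G.
Proof.
case=> s [/andP[es Us] s_gt2 sT].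
have H i : 0 < i < 4 -> o i = next s (o 0) \/ o i = prev s (o 0).
  move=> i4; have := next_neq_prev Us s_gt2 (sT (o i)).
  have := next_cycle es (sT (o i)); have := prev_cycle es (sT (o i)).
  rewrite /= /net_rel /netR -val_eqE /= oK; last by lia.
  move=> pi ni np.
  (* The two cycle neighbours of b_i are distinct and lie in {c, a_i}, so one of them is c. *)
  have [E|E] : next s (o i) = o 0 \/ prev s (o i) = o 0.
    have [E|E] : val (next s (o i)) = 0 \/ val (prev s (o i)) = 0.
    - by move: pi ni np => /=; lia.
    - by left; apply/val_inj; rewrite E /= oK.
    - by right; apply/val_inj; rewrite E /= oK.
  - by right; rewrite -E prev_next.
  - by left; rewrite -E next_prev.
have V i : 0 < i < 4 -> i = next s (o 0) \/ i = prev s (o 0).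
  by move=> i4; have [<-|<-] := H i i4; rewrite oK; lia.
(* Pigeonhole: three distinct labels cannot all be among the two cycle neighbours of c. *)
by have := V 1 isT; have := V 2 isT; have := V 3 isT; lia.
Qed.

Lemma ncomp_net_le S : 2 <= ncomp G S -> ncomp G S <= #|S|.
Proof.
have eC := @del_connect_sym _ G S.
have [S0 _|S0] := boolP (o 0 \in S); last first.
  rewrite ltnNge (@card_roots_in_le1 _ _ _ (o 0)) // => y.
  rewrite inE => yS; have [->//|y0] := eqVneq y (o 0).
  apply: connect1; rewrite /del_rel S0 yS /= /net_rel /netR oK //=.
  by rewrite andbT; move: y0; rewrite -val_eqE /= oK // eq_sym.
(* An injection from component roots into [S]: an isolated b_i is charged to a_i, and the component
   meeting K is charged to c. *)
pose f (r : 'I_n) := if (r < 4) && (o (r + 3) \in S) then o (r + 3) else o 0.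
pose R := [predI roots (del_rel G S) & ~: S].
rewrite -[ncomp G S]/#|R|.
(* A root charged to c reaches a surviving vertex of K: itself, or a_i if it is b_i. *)
have far r : r \in R -> ~~ ((r < 4) && (o (r + 3) \in S)) ->
    exists a : 'I_n, [/\ 3 < a, a \notin S & connect (del_rel G S) r a].
  rewrite !inE => /andP[_ rS]; case: ltnP => [r4 /= r3S|r4 _]; last by exists r.
  have r0 : val r != 0.
    by apply: contraNneq rS => E; rewrite (_ : r = o 0) //; apply/val_inj; rewrite /= oK.
  exists (o (r + 3)); rewrite oK; last by lia.
  split=> //; first by move: r0 => /=; lia.
  apply: connect1; rewrite /del_rel rS r3S /= /net_rel /netR oK; lia.
have finj : {in R &, injective f}.
  move=> r r' rR r'R; rewrite /f.
  case: ifPn => [/andP[r4 _]|/(far r rR)[a [a3 aS ra]]];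
    case: ifPn => [/andP[r'4 _]|/(far r' r'R)[a' [a'3 a'S ra']]].
  - by move/(congr1 val); rewrite /= !oK; try lia; move=> E; apply/val_inj => /=; lia.
  - by move/(congr1 val); rewrite /= !oK; lia.
  - by move/(congr1 val); rewrite /= !oK; lia.
  (* Two roots charged to c are joined through the clique K - S, hence equal. *)
  move=> _; have aa' : connect (del_rel G S) a a'.
    have [->//|neq] := eqVneq a a'.
    apply: connect1; rewrite /del_rel aS a'S /= /net_rel /netR.
    by move: neq; rewrite -val_eqE /=; lia.
  move: rR r'R; rewrite !inE => /andP[/eqP <- _] /andP[/eqP <- _].
  apply/(fingraph.rootP eC); apply: connect_trans ra (connect_trans aa' _).
  by rewrite eC.
rewrite -(card_in_imset finj); apply/subset_leq_card/subsetP => _ /imsetP[r _ ->].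
by rewrite /f; case: ifPn => // /andP[].
Qed.

Lemma net_toughness : toughness G = 1%E.
Proof.
apply: (@toughness_eq1 _ _ [set o 0; o 4] _ ncomp_net_le).
- apply/forallPn; exists (o 1); apply/forallPn; exists (o 2).
  by rewrite -val_eqE /= /net_rel /netR !oK.
- apply: (n_comp_gt1 (x := o 1) (y := o 2) (@del_connect_sym _ _ _) (@del_closed _ _ _)).
  + by rewrite !inE -!val_eqE /= !oK.
  + by rewrite !inE -!val_eqE /= !oK.
  (* Both neighbours c and a1 of b1 are deleted, so b1 is a component by itself and is separated
     from b2. *)
  suff c1 : closed (del_rel G [set o 0; o 4]) (pred1 (o 1)).
    apply/negP => /(closed_connect c1).
    by rewrite !inE -!val_eqE /= !oK.
  move=> u v; rewrite /del_rel !inE -!val_eqE /= !oK // /net_rel /netR; lia.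
- by rewrite cards2 -val_eqE /= !oK.
Qed.

End Net.

Theorem theorem7 (n : nat) (hn : 7 <= n) :
  exists G : sgraph 'I_n,
    (exists x y : 'I_n,
       [/\ x != y, ~~ adj G x y, deg G x + deg G y = n - 1,
           hamiltonian (add_edge G x y) & ~ hamiltonian G])
    /\ toughness G = 1%E.
Proof.
have [m {hn}->] : exists m, n = 7 + m by exists (n - 7); lia.
exists (net (7 + m)); split; last exact: net_toughness.
exists (inord 1), (inord 5); split.
- by rewrite -val_eqE /= !inordK.
- by rewrite /= /net_rel /netR !inordK.
- by rewrite deg_net1 deg_net5; lia.
- exact: net_add_edge_hamiltonian.
- exact: net_not_hamiltonian.
Qed.
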